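(* Let $n\ge 2$. Suppose there exist a collinear $n$-body central configuration $\mathbf{q}=(\mathbf{q}_1,\dots,\mathbf{q}_n)$ with masses $m_1,\dots,m_n$, a mass $m_0$ and a position $\mathbf{q}_0$ such that the extended configuration $\bar{\mathbf{q}}=(\mathbf{q}_0,\mathbf{q}_1,\dots,\mathbf{q}_n)$ with masses $m_0,m_1,\dots,m_n$ is a collinear $(n+1)$-body central configuration. Then $n=2$.
   Context: All configurations are in $\mathbb{R}^3$, all masses are positive, and the bodies of a configuration occupy pairwise distinct positions. For bodies with masses $m_1,\dots,m_k$ at $\mathbf{q}_1,\dots,\mathbf{q}_k$ ($k\ge2$) put $m=\sum_i m_i$, $c=\frac1m\sum_i m_i\mathbf{q}_i$, $U=\sum_{i<j}\frac{m_im_j}{|\mathbf{q}_i-\mathbf{q}_j|}$, $I=\sum_i m_i|\mathbf{q}_i-c|^2$. The configuration is central if $\nabla U+\frac{\lambda}{2}\nabla I=0$ with $\lambda=U/I$, i.e. $\sum_{j\ne i} m_im_j\frac{\mathbf{q}_j-\mathbf{q}_i}{|\mathbf{q}_j-\mathbf{q}_i|^3}=-\lambda m_i(\mathbf{q}_i-c)$ for all $i$. A configuration is collinear if all its bodies lie on one line. *)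

(* Defs.v *)
From mathcomp Require Import all_boot all_order all_algebra.
From mathcomp Require Import reals.

Set Implicit Arguments.
Unset Strict Implicit.
Unset Printing Implicit Defensive.

Import Order.TTheory GRing.Theory Num.Theory.
Local Open Scope ring_scope.

(* The Euclidean norm; the norm that the library puts on row vectors is the
   sup norm. *)
Definition enorm (R : realType) (v : 'rV[R]_3) : R :=
  Num.sqrt (\sum_(i < 3) v 0 i ^+ 2).

Definition total_mass (R : realType) (k : nat) (m : 'I_k -> R) : R :=
  \sum_(i < k) m i.

Definition center_of_mass (R : realType) (k : nat)
    (m : 'I_k -> R) (q : 'I_k -> 'rV[R]_3) : 'rV[R]_3 :=
  (total_mass m)^-1 *: \sum_(i < k) m i *: q i.

Definition potential (R : realType) (k : nat)
    (m : 'I_k -> R) (q : 'I_k -> 'rV[R]_3) : R :=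
  \sum_(i < k) \sum_(j < k | (i < j)%N) m i * m j / enorm (q i - q j).

Definition inertia (R : realType) (k : nat)
    (m : 'I_k -> R) (q : 'I_k -> 'rV[R]_3) : R :=
  \sum_(i < k) m i * enorm (q i - center_of_mass m q) ^+ 2.

Definition multiplier (R : realType) (k : nat)
    (m : 'I_k -> R) (q : 'I_k -> 'rV[R]_3) : R :=
  potential m q / inertia m q.

(* The last clause is grad U + (lambda / 2) grad I = 0, written out body by
   body: its left-hand side is the gradient of U with respect to q i, and
   2 m i (q i - c) is that of I. *)
Definition central_configuration (R : realType) (k : nat)
    (m : 'I_k -> R) (q : 'I_k -> 'rV[R]_3) : Prop :=
  [/\ forall i, 0 < m i,
      injective q
    & forall i,
        \sum_(j < k | j != i)
           (m i * m j / enorm (q j - q i) ^+ 3) *: (q j - q i) =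
        - (multiplier m q * m i) *: (q i - center_of_mass m q)].

Definition collinear (R : realType) (k : nat) (q : 'I_k -> 'rV[R]_3) : Prop :=
  exists p d : 'rV[R]_3,
    d != 0 /\ forall i, exists t : R, q i = p + t *: d.

(* The family (x0, x 0, ..., x (n - 1)). *)
Definition extend (T : Type) (n : nat) (x0 : T) (x : 'I_n -> T)
    (i : 'I_n.+1) : T :=
  if unlift ord0 i is Some j then x j else x0.

(* Main.v *)
(** Subtracting the equations of the two configurations for a common body [i]
    leaves only the attraction of the added body, which must therefore be an
    affine function of the position of [i].  In the coordinate [u] along the
    line, with the added body at the origin, this reads [u / |u|^3 = a u + b].
    The left-hand side has the sign of [u] and is decreasing in [u] on either
    side of [0], so two solutions of opposite signs force [a > 0] and two
    solutions of the same sign force [a < 0]; three solutions thus lie on the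
    same side.  There they are roots of a cubic [a u^3 + b u^2 - 1] without
    linear term, which is impossible for three distinct positive numbers.
    Hence there are at most two common bodies. *)

Require Import Defs.
From mathcomp Require Import all_boot all_order all_algebra.
From mathcomp Require Import reals ring lra.

Set Implicit Arguments.
Unset Strict Implicit.
Unset Printing Implicit Defensive.

Import Order.TTheory GRing.Theory Num.Theory.
Local Open Scope ring_scope.

Section InverseSquare.
Variable R : realFieldType.
Implicit Types a b x y z : R.

(** At [x = 0] division by zero makes the left-hand side [0], so lemmas that fix no sign ask for
    [x != 0] separately. *)
Definition on_affine a b x : Prop := x / `|x| ^+ 3 = a * x + b.

(** Reflection in the added body, which reduces the negative side to the positive one. *)
Lemma on_affineN a b x : on_affine a b x -> on_affine a (- b) (- x).
Proof. by rewrite /on_affine normrN mulNr => ->; ring. Qed.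

Lemma on_affine_pos a b x : 0 < x -> on_affine a b x -> (a * x + b) * x ^+ 2 = 1.
Proof.
move=> x0 <-; rewrite gtr0_norm //; field; exact: lt0r_neq0.
Qed.

Lemma on_affine_slope_gt0 a b x y :
  x < 0 -> 0 < y -> on_affine a b x -> on_affine a b y -> 0 < a.
Proof.
move=> x0 y0 ex ey.
have fx : a * x + b < 0.
  by rewrite -ex pmulr_llt0 // invr_gt0 exprn_gt0 // normr_gt0 lt_eqF.
have fy : 0 < a * y + b.
  by rewrite -ey divr_gt0 // exprn_gt0 // normr_gt0 gt_eqF.
have xy : 0 < y - x by lra.
rewrite -(pmulr_lgt0 a xy) mulrBr; lra.
Qed.

(** If [a] were nonnegative, [(a * x + b) * x ^+ 2] would grow strictly from one solution to the
    other, yet it equals [1] at both. *)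
Lemma on_affine_pos_slope_lt0 a b x y : x != y ->
  0 < x -> 0 < y -> on_affine a b x -> on_affine a b y -> a < 0.
Proof.
wlog xy : x y / x < y => [H xy x0 y0 ex ey|_ x0 y0 ex ey].
  by case/orP: (lt_total xy) => l; [exact: (H x y)|apply: (H y x); rewrite 1?eq_sym].
have := on_affine_pos x0 ex; have := on_affine_pos y0 ey => fy fx.
have fx0 : 0 < a * x + b.
  by rewrite -(pmulr_lgt0 _ (exprn_gt0 2 x0)) fx ltr01.
have x2y2 : x ^+ 2 < y ^+ 2 by rewrite ltr_pXn2r // nnegrE ltW.
rewrite ltNge; apply/negP => a0.
have le_f : a * x + b <= a * y + b by rewrite lerD2r ler_wpM2l // ltW.
have : (a * x + b) * x ^+ 2 < (a * y + b) * y ^+ 2.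
  apply: lt_le_trans (ler_wpM2r (exprn_ge0 2 (ltW y0)) le_f).
  by rewrite ltr_pM2l.
by rewrite fx fy ltxx.
Qed.

Lemma on_affine_same_sign a b x y : x != y -> x != 0 -> y != 0 ->
  on_affine a b x -> on_affine a b y -> (0 < x) = (0 < y) -> a < 0.
Proof.
move=> xy x0 y0 ex ey sxy.
have [xp|] := ltP 0 x.
  by apply: (on_affine_pos_slope_lt0 xy xp _ ex ey); rewrite -sxy.
rewrite le_eqVlt (negPf x0) /= => xn.
have yn : y < 0 by rewrite lt_neqAle y0 /= leNgt -sxy -leNgt ltW.
by apply: (on_affine_pos_slope_lt0 _ _ _ (on_affineN ex) (on_affineN ey));
  rewrite ?oppr_gt0 // eqr_opp.
Qed.

Lemma on_affine_opposite_sign a b x y : x != 0 -> y != 0 ->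
  on_affine a b x -> on_affine a b y -> (0 < x) != (0 < y) -> 0 < a.
Proof.
move=> x0 y0 ex ey.
case: (ltgtP 0 x) x0 => // [xp|xn].
- case: (ltgtP 0 y) y0 => // [yn _ _ _].
  exact: (on_affine_slope_gt0 yn xp ey ex).
- case: (ltgtP 0 y) y0 => // yp _ _ _.
  exact: (on_affine_slope_gt0 xn yp ex ey).
Qed.

Lemma on_affine_three_pos a b x y z :
  x != y -> y != z -> x != z -> 0 < x -> 0 < y -> 0 < z ->
  on_affine a b x -> on_affine a b y -> on_affine a b z -> False.
Proof.
move=> xy yz xz x0 y0 z0 ex ey ez.
have := (on_affine_pos x0 ex, on_affine_pos y0 ey, on_affine_pos z0 ez).
move=> [[fx fy] fz].
(* Differences of two cubic equations, divided by the difference of the roots. *)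
have exy : a * (x ^+ 2 + x * y + y ^+ 2) + b * (x + y) = 0.
  by apply: (mulfI (x := x - y)); rewrite ?subr_eq0 //; lra.
have eyz : a * (y ^+ 2 + y * z + z ^+ 2) + b * (y + z) = 0.
  by apply: (mulfI (x := y - z)); rewrite ?subr_eq0 //; lra.
(* The same division applied to the two quotients. *)
have exyz : a * (x + y + z) + b = 0.
  by apply: (mulfI (x := x - z)); rewrite ?subr_eq0 //; lra.
have eb : b = - a * (x + y + z) by lra.
(* Vieta: this is the linear coefficient of the cubic, which is zero. *)
have e2 : a * (x * y + y * z + x * z) = 0.
  by move: exy; rewrite eb => exy; lra.
have : 0 < x * y + y * z + x * z by rewrite !addr_gt0 // mulr_gt0.
move=> /lt0r_neq0 /negPf e2n0.
move/eqP: e2; rewrite mulf_eq0 e2n0 orbF => /eqP a0.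
by move: fx; rewrite eb a0 oppr0 !mul0r addr0 mul0r => /eqP; rewrite eq_sym oner_eq0.
Qed.

Lemma on_affine_three a b x y z :
  x != y -> y != z -> x != z -> x != 0 -> y != 0 -> z != 0 ->
  on_affine a b x -> on_affine a b y -> on_affine a b z -> False.
Proof.
move=> xy yz xz x0 y0 z0 ex ey ez.
have opp := (on_affine_opposite_sign x0 y0 ex ey,
  on_affine_opposite_sign y0 z0 ey ez, on_affine_opposite_sign x0 z0 ex ez).
have same := (on_affine_same_sign xy x0 y0 ex ey,
  on_affine_same_sign yz y0 z0 ey ez, on_affine_same_sign xz x0 z0 ex ez).
have abs : 0 < a -> a < 0 -> False by move=> ap an; move: (lt_trans ap an); rewrite ltxx.
move: opp same; case: (ltgtP 0 x) x0 => // [xp _|xn _].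
- case: (ltgtP 0 y) y0 => // [yp _|yn _].
  + case: (ltgtP 0 z) z0 => // [zp _ _ _|zn _].
      exact: (on_affine_three_pos xy yz xz xp yp zp ex ey ez).
    by move=> [[_ h] _] [[k _] _]; apply: abs; [apply: h|apply: k].
  (* Whichever sign [z] has, it agrees with that of [x] or of [y], so [a < 0] against [0 < a]. *)
  + move=> [[h _] _] [[_ k1] k2]; apply: abs; first exact: h.
    by case: (0 < z) k1 k2 => k1 k2; [apply: k2|apply: k1].
- case: (ltgtP 0 y) y0 => // [yp _|yn _].
  + move=> [[h _] _] [[_ k1] k2]; apply: abs; first exact: h.
    by case: (0 < z) k1 k2 => k1 k2; [apply: k1|apply: k2].
  + case: (ltgtP 0 z) z0 => // [zp _|zn _ _ _].
      by move=> [[_ h] _] [[k _] _]; apply: abs; [apply: h|apply: k].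
    by apply: (@on_affine_three_pos a (- b) (- x) (- y) (- z));
      rewrite ?eqr_opp ?oppr_gt0 //; apply: on_affineN.
Qed.

End InverseSquare.

Section Stacking.
Variable R : realType.
Implicit Types (d : 'rV[R]_3) (n : nat).

Lemma enormZ (s : R) d : enorm (s *: d) = `|s| * enorm d.
Proof.
rewrite /enorm -sqrtr_sqr -sqrtrM ?sqr_ge0 // mulr_sumr.
by congr Num.sqrt; apply: eq_bigr => i _; rewrite mxE exprMn.
Qed.

Lemma enorm_gt0 d : d != 0 -> 0 < enorm d.
Proof.
move=> /rV0Pn [k dk]; rewrite sqrtr_gt0 (bigD1 k) //=.
by apply: ltr_pwDl; rewrite ?exprn_even_gt0 ?sumr_ge0 // => i _; apply: sqr_ge0.
Qed.

Lemma extend0 (T : Type) n (x0 : T) (x : 'I_n -> T) : extend x0 x ord0 = x0.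
Proof. by rewrite /extend unlift_none. Qed.

Lemma extend_lift (T : Type) n (x0 : T) (x : 'I_n -> T) i :
  extend x0 x (lift ord0 i) = x i.
Proof. by rewrite /extend liftK. Qed.

(** The forces among the common bodies cancel on subtraction. Dividing by [m i] leaves coefficients
    independent of [i]: the difference of the multipliers, and a combination of the two centers of
    mass. *)
Lemma attraction_affine n (m : 'I_n -> R) (q : 'I_n -> 'rV[R]_3) m0 q0 :
  central_configuration m q ->
  central_configuration (extend m0 m) (extend q0 q) ->
  exists (l : R) (v : 'rV[R]_3), forall i,
    (m0 / enorm (q0 - q i) ^+ 3) *: (q0 - q i) = l *: q i + v.
Proof.
move=> [mp _ eq] [_ _ eq'].
set l := multiplier m q in eq; set c := center_of_mass m q in eq.
set l' := multiplier _ _ in eq'; set c' := center_of_mass _ _ in eq'.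
exists (l - l'), (l' *: c' - l *: c) => i.
have mi : m i != 0 by rewrite gt_eqF.
have := eq' (lift ord0 i).
rewrite (bigD1 ord0) //= !extend0 !extend_lift.
(* The condition excludes [ord0], so the remaining sum is the force on body [i] within [q]. *)
rewrite big_mkcond big_ord_recl /= add0r.
under eq_bigr => j _ do
  rewrite !extend_lift (inj_eq (@lift_inj _ ord0)) andbT.
rewrite -big_mkcond eq => e.
apply: (scalerI mi); apply: (addIr (- (l * m i) *: (q i - c))).
rewrite scalerA mulrA e; apply/rowP => k; rewrite !mxE; ring.
Qed.

End Stacking.

Theorem theorem1 (R : realType) (n : nat) (hn : (2 <= n)%N)
    (hstack : exists (m : 'I_n -> R) (q : 'I_n -> 'rV[R]_3)
                     (m0 : R) (q0 : 'rV[R]_3),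
        [/\ central_configuration m q,
            collinear q,
            central_configuration (extend m0 m) (extend q0 q)
          & collinear (extend q0 q)]) :
  n = 2%N.
Proof.
case: hstack => m [q [m0 [q0 [cc _ cc' [p [d [d0 line]]]]]]].
have [l [v aff]] := attraction_affine cc cc'.
case: cc cc' => _ injq _ [mp' injq' _].
have m0p : 0 < m0 by have := mp' ord0; rewrite extend0.
have [t0 q0E] : exists t0, q0 = p + t0 *: d.
  by have := line ord0; rewrite extend0.
have {}line i : exists u, q i - q0 = u *: d.
  have [t] := line (lift ord0 i); rewrite extend_lift q0E => ->.
  by exists (t - t0); rewrite scalerBl opprD addrACA subrr add0r.
(* A coordinate where [d] is nonzero makes the vector equation scalar. *)
have [k dk] := rV0Pn _ d0.
have ed := enorm_gt0 d0.
have u_neq i u : q i - q0 = u *: d -> u != 0.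
  move=> hu; apply/eqP => uz; move: hu; rewrite uz scale0r => /eqP.
  rewrite subr_eq0 -(extend_lift q0 q) -{2}(extend0 q0 q).
  by move=> /eqP /injq'.
(* With [q i = q0 + u *: d], the attraction is [- m0 * u / (|u| * enorm d) ^+ 3] times [d]; solving
   its coordinate [k] for [u / |u| ^+ 3] gives these coefficients. *)
have {}aff i u : q i - q0 = u *: d ->
    on_affine (- l * enorm d ^+ 3 / m0)
      (- (l * q0 0 k + v 0 k) * enorm d ^+ 3 / (m0 * d 0 k)) u.
  move=> hu; have u0 := u_neq _ _ hu.
  have := aff i.
  rewrite -[q0 - q i]opprB hu -scaleNr enormZ normrN.
  rewrite (_ : q i = q0 + u *: d); last by rewrite -hu addrC subrK.
  move=> /(congr1 (fun w : 'rV[R]_3 => w 0 k)); rewrite !mxE => e.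
  have un : `|u| != 0 by rewrite normr_eq0.
  have edn : enorm d != 0 by rewrite gt_eqF.
  have m0n : m0 != 0 by rewrite gt_eqF.
  rewrite /on_affine.
  have -> : u / `|u| ^+ 3 =
      - (m0 / (`|u| * enorm d) ^+ 3 * (- u * d 0 k)) * enorm d ^+ 3
        / (m0 * d 0 k).
    by field; rewrite ?un ?edn ?m0n ?dk.
  by rewrite e; field; rewrite ?m0n ?dk.
have u_inj i j u w : q i - q0 = u *: d -> q j - q0 = w *: d -> i != j -> u != w.
  move=> hu hw; apply: contraNneq => uw; apply/eqP/injq.
  by apply: (addIr (- q0)); rewrite hu hw uw.
apply/eqP; rewrite eqn_leq hn andbT leqNgt; apply/negP => n3.
(* Three bodies of [q] would give three distinct nonzero solutions with the same coefficients. *)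
pose i0 := Ordinal (ltn_trans (isT : 0 < 2)%N n3).
pose i1 := Ordinal (ltn_trans (isT : 1 < 2)%N n3).
pose i2 := Ordinal n3.
have [[[x hx] [y hy]] [z hz]] := (line i0, line i1, line i2).
exact: (on_affine_three (u_inj _ _ _ _ hx hy isT) (u_inj _ _ _ _ hy hz isT)
  (u_inj _ _ _ _ hx hz isT) (u_neq _ _ hx) (u_neq _ _ hy) (u_neq _ _ hz)
  (aff _ _ hx) (aff _ _ hy) (aff _ _ hz)).
Qed.
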